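(* Let $m,n\ge 1$ be integers with $mn\ge 2$. Every height function $h$ on $G_{m,n}$ is the lower envelope $E_{A,c}$ of a unique admissible configuration $(A,c)$; its apex set $A=\{p_1,\dots,p_a\}$ is the set of strict local minima of $h$, and its offsets are $c_s=h(p_s)$. This gives a bijection between the height functions on $G_{m,n}$ and the admissible configurations on $G_{m,n}$.
   Context: $G_{m,n}$ is the $m\times n$ grid graph: its cells are $(i,j)$ with $1\le i\le m$, $1\le j\le n$, two cells being adjacent when they differ by one in a single coordinate. $d_1((i,j),(i',j'))=|i-i'|+|j-j'|$. A height function on $G_{m,n}$ is a map $h\colon G_{m,n}\to\mathbb{Z}$ with $|h(u)-h(v)|=1$ on every edge $uv$ and $h(1,1)=0$. A cell is a strict local minimum of $h$ if every neighbour has value larger by one. A configuration on $G_{m,n}$ is a pair $(A,c)$ where $A=\{p_1,\dots,p_a\}\subseteq G_{m,n}$ is a set of $a\ge 1$ distinct cells (the apexes) and $c=(c_1,\dots,c_a)\in\mathbb{Z}^a$ assigns to each apex $p_s$ an integer offset $c_s$ (so $c$ is a function on $A$; the ordering of the apexes is immaterial). Its lower envelope is $E_{A,c}(v)=\min_{1\le s\le a}\big(c_s+d_1(p_s,v)\big)$. The configuration is admissible if (i) (activity) $c_s<c_t+d_1(p_t,p_s)$ for all $s$ and all $t\ne s$; (ii) (parity) $c_s-c_t\equiv d_1(p_s,p_t)\pmod 2$ for all $s,t$; and (iii) $E_{A,c}(1,1)=0$. *)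

(* Defs.v *)
From mathcomp Require Import all_boot all_order all_algebra.

Set Implicit Arguments.
Unset Strict Implicit.
Unset Printing Implicit Defensive.

Import Order.TTheory GRing.Theory Num.Theory.
Local Open Scope ring_scope.

(* Coordinates are shifted by one: the cell (i, j) with 1 <= i <= m and
   1 <= j <= n is the pair of ordinals of values i - 1 and j - 1. *)
Definition cell (m n : nat) : finType := ('I_m * 'I_n)%type.

(* The cell (1,1); it exists only when m and n are positive. *)
Definition corner (m n : nat) (hm : (0 < m)%N) (hn : (0 < n)%N) : cell m n :=
  (Ordinal hm, Ordinal hn).

Definition dist (i j : nat) : nat := `|i%:Z - j%:Z|%N.

Definition adjacent (m n : nat) (u v : cell m n) : bool :=
  (u.1 == v.1) && (dist u.2 v.2 == 1%N) || (u.2 == v.2) && (dist u.1 v.1 == 1%N).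

Definition d1 (m n : nat) (u v : cell m n) : nat :=
  (dist u.1 v.1 + dist u.2 v.2)%N.

Definition is_height (m n : nat) (hm : (0 < m)%N) (hn : (0 < n)%N)
    (h : {ffun cell m n -> int}) : bool :=
  [forall u, forall v, adjacent u v ==> (`|h u - h v| == 1)]
  && (h (corner hm hn) == 0).

Definition strict_local_min (m n : nat) (h : {ffun cell m n -> int})
    (u : cell m n) : bool :=
  [forall v, adjacent u v ==> (h v == h u + 1)].

(* The offsets are a function on the subtype of apexes, so that equality of
   configurations is equality of the pairs (A, c). *)
Record config (m n : nat) := Config {
  apexes : {set cell m n};
  offset : {ffun {p : cell m n | p \in apexes} -> int};
  apexes_neq0 : apexes != set0
}.

Definition apex (m n : nat) (C : config m n) : finType :=
  {p : cell m n | p \in apexes C}.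

Definition some_apex (m n : nat) (C : config m n) : apex C :=
  let exA := elimT (set0Pn (apexes C)) (apexes_neq0 C) in
  exist _ (xchoose exA) (xchooseP exA).

Definition cone (m n : nat) (C : config m n) (s : apex C) (v : cell m n) : int :=
  offset C s + (d1 (val s) v)%:Z.

(* Since int has no top element, the minimum is seeded with the value at one
   of the apexes, which does not change it. *)
Definition envelope (m n : nat) (C : config m n) : {ffun cell m n -> int} :=
  [ffun v => \big[Num.min/cone (some_apex C) v]_(s : apex C) cone s v].

Definition active (m n : nat) (C : config m n) : bool :=
  [forall s : apex C, forall t : apex C,
    (t != s) ==> (offset C s < offset C t + (d1 (val t) (val s))%:Z)].

Definition parity (m n : nat) (C : config m n) : bool :=
  [forall s : apex C, forall t : apex C,
    (offset C s - offset C t == (d1 (val s) (val t))%:Z %[mod 2])%Z].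

Definition admissible (m n : nat) (hm : (0 < m)%N) (hn : (0 < n)%N)
    (C : config m n) : bool :=
  [&& active C, parity C & envelope C (corner hm hn) == 0].

(* Main.v *)
Require Import Defs.
From mathcomp Require Import all_boot all_order all_algebra zify.

(** Activity says that every apex [s] lies strictly below all the other cones,
    so the envelope takes the value [offset s] there and increases by one on
    leaving [s]; hence apexes are strict local minima.  From any other cell a
    step towards the apex of a minimal cone lowers the envelope, so there are
    no further strict local minima ([strict_local_min_envelope]).  The apexes
    and the offsets can thus be read off the envelope, which gives uniqueness
    ([admissible_envelope_inj]).  Parity makes all cones congruent modulo 2 at
    each cell, so that the envelope, a minimum of 1-Lipschitz functions, changes
    by exactly one along each edge ([unit_steps_envelope]).

    Conversely, a height function [h] is 1-Lipschitz for [d1], so it lies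
    below every cone issued from one of its strict local minima.
    Walking downhill from [v] for as long as some neighbour is lower ends at a
    strict local minimum [p], and the length of the walk is exactly
    [h v - h p]; being at least [d1 p v], it equals [d1 p v] by the Lipschitz
    bound, so the cone at [p] passes through [(v, h v)]
    ([descent_to_strict_local_min]). *)

Set Implicit Arguments.
Unset Strict Implicit.
Unset Printing Implicit Defensive.

Import Order.TTheory GRing.Theory Num.Theory.

(** * The grid metric *)

Section Grid.

Variables m n : nat.
Implicit Types u v w p : cell m n.

Lemma cell_eqE u v : (u == v) = (u.1 == v.1 :> nat) && (u.2 == v.2 :> nat).
Proof. by rewrite -[u == v]/((u.1 == v.1) && (u.2 == v.2)) -!val_eqE. Qed.

Lemma adjacentE u v : adjacent u v = (d1 u v == 1).
Proof. rewrite /adjacent /d1 /dist -!val_eqE /=; lia. Qed.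

Lemma d1C u v : d1 u v = d1 v u.
Proof. rewrite /d1 /dist; lia. Qed.

Lemma d1xx u : d1 u u = 0.
Proof. rewrite /d1 /dist; lia. Qed.

Lemma d1_triangle v u w : d1 u w <= d1 u v + d1 v w.
Proof. rewrite /d1 /dist; lia. Qed.

(** The grid is bipartite: the colour of [(i, j)] is the parity of [i + j]. *)
Lemma odd_d1D v u w : odd (d1 u w) = odd (d1 u v) (+) odd (d1 v w).
Proof. rewrite /d1 /dist; lia. Qed.

(** [d1] is the path metric of the grid, stated as the existence of the first
    step of a geodesic: move by one in a coordinate where [u] and [p] differ. *)
Lemma step_towards p u : u != p ->
  exists2 v, adjacent u v & d1 p u = (d1 p v).+1.
Proof.
case: p u => [[i hi] [j hj]] [[k hk] [l hl]]; rewrite cell_eqE /= => neq.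
case: (ltngtP k i) => ki.
- have h : k.+1 < m by lia.
  exists (Ordinal h, Ordinal hl); rewrite ?adjacentE /d1 /dist /=; lia.
- have h : k.-1 < m by lia.
  exists (Ordinal h, Ordinal hl); rewrite ?adjacentE /d1 /dist /=; lia.
case: (ltngtP l j) => lj.
- have h : l.+1 < n by lia.
  exists (Ordinal hk, Ordinal h); rewrite ?adjacentE /d1 /dist /=; lia.
- have h : l.-1 < n by lia.
  exists (Ordinal hk, Ordinal h); rewrite ?adjacentE /d1 /dist /=; lia.
lia.
Qed.

End Grid.

(** * Functions with unit steps and their strict local minima *)

Section UnitSteps.

Local Open Scope ring_scope.

Variables m n : nat.
Implicit Types (u v p : cell m n) (h : {ffun cell m n -> int}).

(** A height function without its normalisation at the corner. *)
Definition unit_steps h := forall u v, adjacent u v -> `|h u - h v| = 1.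

Lemma is_heightP (hm : (0 < m)%N) (hn : (0 < n)%N) h :
  reflect (unit_steps h /\ h (corner hm hn) = 0) (is_height hm hn h).
Proof.
apply: (iffP andP) => -[steps /eqP h0]; split=> //.
- by move=> u v uv; apply/eqP; exact: (implyP (forallP (forallP steps u) v)).
- by apply/forallP => u; apply/forallP => v; apply/implyP => /steps ->.
Qed.

Lemma strict_local_minP h p :
  reflect (forall v, adjacent p v -> h v = h p + 1) (strict_local_min h p).
Proof.
apply: (iffP forallP) => [minp v pv | minp v].
- by apply/eqP; exact: (implyP (minp v)).
- by apply/implyP => /minp ->.
Qed.

Variable h : {ffun cell m n -> int}.
Hypothesis steps : unit_steps h.

Lemma unit_steps_lipschitz p v : h v <= h p + (d1 p v)%:Z.
Proof.
have [k] := ubnP (d1 p v); elim: k v => // k IHk v.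
have [-> _ | vp dk] := eqVneq v p; first by rewrite lerDl.
have [u vu du] := step_towards vp.
have := steps vu; have := IHk u; lia.
Qed.

Lemma unit_steps_parity p v : (h p - h v == (d1 p v)%:Z %[mod 2])%Z.
Proof.
have [k] := ubnP (d1 p v); elim: k v => // k IHk v.
have [-> _ | vp dk] := eqVneq v p.
  by rewrite d1xx subrr.
have [u vu du] := step_towards vp.
have := steps vu; have := IHk u; lia.
Qed.

(** The induction follows a downhill walk, which stops because [h] attains a
    minimum on the finite grid; the measure is the height above it. *)
Lemma descent_to_strict_local_min v :
  exists2 p, strict_local_min h p & h v = h p + (d1 p v)%:Z.
Proof.
have [v0 h_min] : exists v0, forall x, h v0 <= h x.
  exists [arg min_(x < v) h x]%O; case: arg_minP => // y _ h_min x.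
  exact: h_min.
have [k] := ubnP `|h v - h v0|%N; elim: k v => // k IHk v vk.
have [minv | /forallPn[u]] := boolP (strict_local_min h v).
  by exists v => //; rewrite d1xx addr0.
rewrite negb_imply => /andP[vu /eqP hu].
have step_vu := steps vu; have hu_min := h_min u.
have [|p minp hup] := IHk u; first by lia.
exists p => //; have := unit_steps_lipschitz p v; have := d1_triangle u p v.
move: vu; rewrite adjacentE (d1C v u); lia.
Qed.

End UnitSteps.

(** * The lower envelope of an admissible configuration *)

Section Envelope.

Local Open Scope ring_scope.

Variables m n : nat.
Implicit Types (u v p : cell m n) (C : config m n).

Lemma envelope_le C (s : apex C) v : envelope C v <= cone s v.
Proof. by rewrite ffunE (bigD1 s) //= ge_min lexx. Qed.

Lemma envelope_attained C v : exists s : apex C, envelope C v = cone s v.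
Proof.
rewrite ffunE; elim/big_ind: _ => [|x y [s ->] [t ->]|s _].
- by exists (some_apex C).
- by case: (leP (cone s v) (cone t v)) => _; [exists s | exists t].
- by exists s.
Qed.

(** The offset may be read at any cell with the same coordinates, which avoids
    transporting it along the equality of the apex sets. *)
Lemma config_ext C1 C2 : apexes C1 = apexes C2 ->
  (forall (s : apex C1) (t : apex C2), val s = val t ->
     offset C1 s = offset C2 t) ->
  C1 = C2.
Proof.
case: C1 C2 => [A1 c1 A1_neq0] [A2 c2 A2_neq0]; rewrite /apex /= => eqA.
case: A2 / eqA c2 A2_neq0 => c2 A2_neq0 eqc.
have -> : c1 = c2 by apply/ffunP => s; exact: eqc.
by congr Config; exact: eq_irrelevance.
Qed.

Lemma activeP C :
  reflect (forall s t : apex C, t != s ->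
             offset C s < offset C t + (d1 (val t) (val s))%:Z) (active C).
Proof.
apply: (iffP forallP) => [act s t | act s].
- exact/implyP/(forallP (act s)).
- by apply/forallP => t; apply/implyP; exact: act.
Qed.

Lemma parityP C :
  reflect (forall s t : apex C,
             (offset C s - offset C t == (d1 (val s) (val t))%:Z %[mod 2])%Z)
          (parity C).
Proof.
apply: (iffP forallP) => [par s t | par s]; first exact: (forallP (par s)).
by apply/forallP.
Qed.

(** Adjacent values differ by at most one since cones are 1-Lipschitz, and by
    an odd number since all the cones have the same parity at a given cell. *)
Lemma unit_steps_envelope C : parity C -> unit_steps (envelope C).
Proof.
move/parityP => par u v; rewrite adjacentE => /eqP uv.
have [s Eu] := envelope_attained C u; have [t Ev] := envelope_attained C v.
have := envelope_le t u; have := envelope_le s v; rewrite Eu Ev /cone.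
have := par s t; have := odd_d1D (val t) (val s) u.
have := odd_d1D u (val t) v; have := d1_triangle u (val s) v.
have := d1_triangle v (val t) u; rewrite (d1C v u) uv; lia.
Qed.

Lemma envelope_apex C : active C ->
  forall s : apex C, envelope C (val s) = offset C s.
Proof.
move/activeP => act s; apply/eqP; rewrite eq_le; apply/andP; split.
  by have := envelope_le s (val s); rewrite /cone d1xx addr0.
have [t ->] := envelope_attained C (val s); rewrite /cone.
by have [-> | /act /ltW //] := eqVneq t s; rewrite lerDl.
Qed.

Lemma strict_local_min_envelope C : active C -> parity C ->
  apexes C = [set p | strict_local_min (envelope C) p].
Proof.
move=> act par; apply/setP => p; rewrite inE; apply/idP/strict_local_minP.
- move=> Cp v pv; pose s : apex C := exist _ p Cp.
  have := unit_steps_envelope par pv.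
  have Ep : envelope C p = offset C s by exact: (envelope_apex act s).
  have [t Ev] := envelope_attained C v; rewrite Ev Ep /cone.
  move: pv; rewrite adjacentE => /eqP pv.
  have [-> | ts] := eqVneq t s; first by rewrite pv; lia.
  (* Activity is strict, so the cone of t is at least offset s + 1 at p and
     hence at least offset s at v; unit steps exclude offset s - 1. *)
  have := activeP C act s t ts; have := d1_triangle v (val t) p.
  by rewrite (d1C v p) pv /=; lia.
- move=> minp; have [s Ep] := envelope_attained C p.
  have [-> | ps] := eqVneq p (val s); first exact: (valP s).
  have [v pv dv] := step_towards ps.
  have := envelope_le s v; rewrite (minp v pv) Ep /cone dv; lia.
Qed.

Lemma admissible_envelope_inj (hm : (0 < m)%N) (hn : (0 < n)%N) C1 C2 :
  admissible hm hn C1 -> admissible hm hn C2 -> envelope C1 = envelope C2 ->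
  C1 = C2.
Proof.
move=> /and3P[act1 par1 _] /and3P[act2 par2 _] eqE; apply: config_ext.
- by rewrite !strict_local_min_envelope // eqE.
- by move=> s t st; rewrite -!envelope_apex // eqE st.
Qed.

Lemma envelope_is_height (hm : (0 < m)%N) (hn : (0 < n)%N) C :
  admissible hm hn C -> is_height hm hn (envelope C).
Proof.
move=> /and3P[_ par /eqP E0]; apply/is_heightP; split=> //.
exact: unit_steps_envelope.
Qed.

End Envelope.

(** * The configuration of strict local minima *)

Section Minima.

Local Open Scope ring_scope.

Variables (m n : nat) (hm : (0 < m)%N) (hn : (0 < n)%N).
Variable h : {ffun cell m n -> int}.
Hypothesis hh : is_height hm hn h.

Let steps : unit_steps h := (is_heightP hm hn h hh).1.

Lemma strict_local_minima_neq0 : [set p | strict_local_min h p] != set0.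
Proof.
have [p minp _] := descent_to_strict_local_min steps (corner hm hn).
by apply/set0Pn; exists p; rewrite inE.
Qed.

Definition minima_config : config m n :=
  Config [ffun s : {p | p \in [set p | strict_local_min h p]} => h (val s)]
         strict_local_minima_neq0.

Lemma offset_minima (s : apex minima_config) :
  offset minima_config s = h (val s).
Proof. by rewrite ffunE. Qed.

Lemma envelope_minima : envelope minima_config = h.
Proof.
apply/ffunP => v; apply/eqP; rewrite eq_le; apply/andP; split.
- have [p minp ->] := descent_to_strict_local_min steps v.
  have Ap : p \in apexes minima_config by rewrite inE.
  have := envelope_le (exist _ p Ap : apex minima_config) v.
  by rewrite /cone offset_minima.
- have [s ->] := envelope_attained minima_config v.
  by rewrite /cone offset_minima; exact: unit_steps_lipschitz.
Qed.

Lemma minima_admissible : admissible hm hn minima_config.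
Proof.
apply/and3P; split.
- apply/activeP => s t ts; rewrite !offset_minima.
  have st : val s != val t by rewrite eq_sym; apply: contra ts => /eqP/val_inj->.
  (* The first step of a geodesic from s to t goes up, since s is a strict
     local minimum; the Lipschitz bound at its end is therefore strict at s. *)
  have [v sv dv] := step_towards st.
  have mins : strict_local_min h (val s) by have := valP s; rewrite inE.
  have := unit_steps_lipschitz steps (val t) v.
  by rewrite (strict_local_minP _ _ mins v sv) dv; lia.
- by apply/parityP => s t; rewrite !offset_minima; exact: unit_steps_parity.
- by rewrite envelope_minima; apply/eqP; exact: (is_heightP hm hn h hh).2.
Qed.

End Minima.

(** * The bijection *)

Theorem theorem4p6 (m n : nat) (hm : (0 < m)%N) (hn : (0 < n)%N)
    (hmn : (2 <= m * n)%N) :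
  (forall h : {ffun cell m n -> int}, is_height hm hn h ->
     (exists! C : config m n, admissible hm hn C /\ envelope C = h)
     /\ (forall C : config m n, admissible hm hn C -> envelope C = h ->
           apexes C = [set p | strict_local_min h p]
           /\ (forall s : apex C, offset C s = h (val s))))
  /\ (exists Phi : {h : {ffun cell m n -> int} | is_height hm hn h} ->
                   {C : config m n | admissible hm hn C},
        bijective Phi
        /\ (forall h, envelope (val (Phi h)) = val h)).
Proof.
split=> [h hh|].
  split=> [|C admC <-].
    exists (minima_config hh); split=> [|C [admC EC]].
      by split; [exact: minima_admissible | exact: envelope_minima].
    apply: (admissible_envelope_inj (minima_admissible hh) admC).
    by rewrite envelope_minima EC.
  have /and3P[act par _] := admC.
  by split=> [|s]; [exact: strict_local_min_envelope | rewrite envelope_apex].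
pose Phi (h : {h : {ffun cell m n -> int} | is_height hm hn h}) :
    {C : config m n | admissible hm hn C} :=
  exist _ (minima_config (valP h)) (minima_admissible (valP h)).
pose Psi (C : {C : config m n | admissible hm hn C}) :
    {h : {ffun cell m n -> int} | is_height hm hn h} :=
  exist _ (envelope (val C)) (envelope_is_height (valP C)).
exists Phi; split=> [|h]; last exact: envelope_minima.
exists Psi => [h | C]; apply: val_inj; first exact: envelope_minima.
apply: (admissible_envelope_inj (minima_admissible _) (valP C)).
exact: envelope_minima.
Qed.
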